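(* Let $d\in(0,1)$, $\alpha>-d$, and let $n\ge 1$ be an integer. Let $v_1,v_2,\ldots$ be independent random variables with $v_i\sim\mathrm{Beta}(1-d,\alpha+id)$ for $i=1,2,\ldots$, and set $\pi_j=v_j\prod_{i=1}^{j-1}(1-v_i)$ for $j=1,2,\ldots$. Let $\mathbf{z}=(\mathbf{z}_1,\ldots,\mathbf{z}_n)$ be a random vector with values in $\mathbb{N}^n$ whose coordinates, conditionally on $\pi=(\pi_j)_{j\ge1}$, are independent and identically distributed with $\mathbb{P}(\mathbf{z}_i=j\mid\pi)=\pi_j$ for all $j\ge1$. Then for every $z=(z_1,\ldots,z_n)\in\mathbb{N}^n$, $$\mathbb{P}(\mathbf{z}=z)=\frac{1}{(\alpha)_{(n)}}\prod_{c\in C_z}\frac{\Gamma(|c|+1-d)}{\Gamma(1-d)}\prod_{j=1}^{m(z)}\frac{\alpha+(j-1)d}{g_j(z)+\alpha+(j-1)d},$$ where, if $\alpha=0$, the right-hand side is understood after cancelling the factor $\alpha$ of $(\alpha)_{(n)}$ against the numerator $\alpha$ of the $j=1$ factor of the last product.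
   Context: $\mathbb{N}=\{1,2,\ldots\}$ and $[n]=\{1,\ldots,n\}$. For $z\in\mathbb{N}^n$: $C_z$ is the partition of $[n]$ into nonempty blocks in which $i$ and $i'$ are in the same block if and only if $z_i=z_{i'}$; $m(z)=\max\{z_1,\ldots,z_n\}$; $g_j(z)=\#\{i\in[n]:z_i\ge j\}$. For a block $c$, $|c|$ is its cardinality. The rising factorial is $(x)_{(m)}=\prod_{j=0}^{m-1}(x+j)$. $\Gamma$ is the gamma function. *)

(* Defs.v *)
From mathcomp Require Export all_boot all_order all_algebra.
From mathcomp Require Export finmap.
From mathcomp Require Export all_classical all_reals all_analysis.
Set Implicit Arguments.
Unset Strict Implicit.
Unset Printing Implicit Defensive.
Import Order.TTheory GRing.Theory Num.Theory.
Import numFieldNormedType.Exports.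
Local Open Scope classical_set_scope.
Local Open Scope ring_scope.

Definition rising (R : realType) (x : R) (m : nat) : R :=
  \prod_(0 <= j < m) (x + j%:R).

(* Convergent, hence meaningful, only for 0 < x. *)
Definition Gamma (R : realType) (x : R) : R :=
  \int[@lebesgue_measure R]_(t in `]0, +oo[) (t `^ (x - 1) * expR (- t)).

(* The library's beta_fun and beta_prob only take natural parameters; these are
   for real parameters 0 < a and 0 < b. *)
Definition Beta (R : realType) (a b : R) : R :=
  \int[@lebesgue_measure R]_(t in `]0, 1[) (t `^ (a - 1) * (1 - t) `^ (b - 1)).

Definition Beta_density (R : realType) (a b t : R) : R :=
  if (0 < t < 1) then t `^ (a - 1) * (1 - t) `^ (b - 1) / Beta a b else 0.

Definition Beta_distributed (R : realType) (dT : measure_display)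
    (T : measurableType dT) (P : probability T R) (X : {RV P >-> R})
    (a b : R) : Prop :=
  forall A : set R, measurable A ->
    distribution P X A = (\int[@lebesgue_measure R]_(t in A) (Beta_density a b t)%:E)%E.

Definition mutually_independent (R : realType) (dT : measure_display)
    (T : measurableType dT) (P : probability T R) (D : set nat)
    (X : nat -> {RV P >-> R}) : Prop :=
  forall J : {fset nat}, [set` J] `<=` D ->
  forall B : nat -> set R, (forall i, measurable (B i)) ->
    P (\bigcap_(i in [set` J]) (X i @^-1` B i)) =
    (\prod_(i <- J) P (X i @^-1` B i))%E.

Definition sigma_of (R : realType) (dT : measure_display)
    (T : measurableType dT) (D : set nat) (Y : nat -> T -> R) : set (set T) :=
  <<s \bigcup_(j in D) g_sigma_algebra_preimage (Y j) >>.

(* f is a version of the conditional probability of the event E given the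
   sub-sigma-algebra G. *)
Definition cond_prob_version (R : realType) (dT : measure_display)
    (T : measurableType dT) (P : probability T R) (G : set (set T))
    (E : set T) (f : T -> R) : Prop :=
  [/\ forall B : set R, measurable B -> G (f @^-1` B),
      P.-integrable setT (EFin \o f) &
      forall A, G A -> (\int[P]_(t in A) (f t)%:E = P (A `&` E))%E].

(* Subfamilies of the X i are covered by taking E i = setT for the others. *)
Definition cond_independent (R : realType) (dT : measure_display)
    (T : measurableType dT) (P : probability T R) (G : set (set T)) (n : nat)
    (X : 'I_n -> {RV P >-> nat}) : Prop :=
  forall (E : 'I_n -> set nat) (f : 'I_n -> T -> R),
    (forall i, cond_prob_version P G (X i @^-1` E i) (f i)) ->
    cond_prob_version P G (\bigcap_(i in setT) (X i @^-1` E i))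
      (fun t => \prod_(i < n) f i t).

(* The sequence is indexed from 1: v 0 is never used. *)
Definition stick_breaking (R : realType) (T : Type) (v : nat -> T -> R)
    (j : nat) : T -> R :=
  fun t => v j t * \prod_(1 <= i < j) (1 - v i t).

Definition level_blocks (n : nat) (z : 'I_n -> nat) : {set {set 'I_n}} :=
  preim_partition z [set: 'I_n]%SET.

Definition max_label (n : nat) (z : 'I_n -> nat) : nat := (\max_(i < n) z i)%N.

Definition count_ge (n : nat) (z : 'I_n -> nat) (j : nat) : nat :=
  #|[set i : 'I_n | (j <= z i)%N]%SET|.

(* Main.v *)
(** Integrating out the labels, [P(Z = z)] is the expectation of
    [\prod_i pi_(z i) = \prod_j v_j ^ e_j (1 - v_j) ^ g_(j+1)], where [e_j] is
    the number of indices with label [j].  By independence this is a product of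
    moments of Beta laws, and the [j]-th one is
    [(1-d)_(e_j) (alpha+jd)_(g_(j+1)) / (alpha+(j-1)d+1)_(g_j)].
    The factors [(1-d)_(e_j)] are the Gamma quotients over the blocks; since
    [x (x+1)_(g) = (x)_(g) (x+g)], the other factors telescope. *)

Require Import Defs.
From mathcomp Require Import ring lra zify.
From mathcomp Require Import measurable_realfun.
Set Implicit Arguments.
Unset Strict Implicit.
Unset Printing Implicit Defensive.
Import Order.TTheory GRing.Theory Num.Theory.
Import numFieldNormedType.Exports.
Local Open Scope classical_set_scope.
Local Open Scope ring_scope.

(** * Expectation of a product of independent variables *)

Section weighted_law.
Local Open Scope ereal_scope.
Import HBNNSimple.

(** The approximating simple functions depend on [phi] alone, so [mu], [Y] and [X] enter the limit
    only through the integrals of [Y] against indicators of events of [X]. This makes different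
    spaces comparable. *)
Lemma integral_weighted_comp (R : realType) d d' (T : measurableType d)
    (U : measurableType d') (mu : {measure set T -> \bar R}) (Y : T -> R)
    (X : T -> U) (phi : U -> \bar R) (mphi : measurable_fun setT phi) :
  measurable_fun setT Y -> (forall t, (0 <= Y t)%R) -> measurable_fun setT X ->
  (forall x, 0 <= phi x) ->
  let g := nnsfun_approx measurableT mphi in
  \int[mu]_t ((Y t)%:E * phi (X t)) =
  limn (fun n => \sum_(y \in range (g n))
    y%:E * \int[mu]_t (Y t * \1_(g n @^-1` [set y]) (X t))%:E).
Proof.
move=> mY Y0 mX phi0 g.
have mgX n : measurable_fun setT (fun t => (g n (X t))%:E).
  by apply/measurable_EFinP; apply: measurableT_comp.
have m1X n y : measurable_fun setT
    (fun t => (\1_(g n @^-1` [set y]) (X t)) : R).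
  by apply: (measurableT_comp _ mX).
transitivity (limn (fun n => \int[mu]_t ((Y t)%:E * (g n (X t))%:E))).
  rewrite -monotone_convergence//.
  - apply: eq_integral => t _; apply/esym/cvg_lim => //.
    by apply: cvgeZl => //; exact: cvg_nnsfun_approx.
  - by move=> n; apply: emeasurable_funM => //; exact/measurable_EFinP.
  - by move=> n t _; rewrite mule_ge0// lee_fin.
  - move=> t _ m n mn; rewrite lee_wpmul2l// lee_fin//.
    exact/lefP/nd_nnsfun_approx.
congr (limn _); apply/funext => n.
transitivity (\int[mu]_t \sum_(y \in range (g n))
    (y%:E * (Y t * \1_(g n @^-1` [set y]) (X t))%:E)).
  apply: eq_integral => t _.
  rewrite fimfunE -fsumEFin// ge0_mule_fsumr; last first.
    by move=> i; exact: nnfun_muleindic_ge0.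
  by apply: eq_fsbigr => y _; rewrite -!EFinM mulrCA.
rewrite ge0_integral_fsum//.
- apply: eq_fsbigr => y /[!inE] -[x _ <-]; rewrite ge0_integralZl//.
  + by apply/measurable_EFinP; exact: measurable_funM.
  + by move=> t _; rewrite lee_fin mulr_ge0.
  + by rewrite lee_fin.
- move=> y; apply: emeasurable_funM => //.
  by apply/measurable_EFinP; exact: measurable_funM.
- move=> y t _; rewrite -EFinM mulrCA EFinM mule_ge0 ?lee_fin//.
  exact: nnfun_muleindic_ge0.
Qed.

(** Serves two purposes: splitting one factor off a product of independent ones ([Y2] constant), and
    replacing the law of a variable by its density ([Y1 = 1], [Y2] the density, [X2] the
    identity). *)
Lemma eq_integral_weighted_comp (R : realType) d1 d2 d'
    (T1 : measurableType d1) (T2 : measurableType d2) (U : measurableType d')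
    (mu1 : {measure set T1 -> \bar R}) (mu2 : {measure set T2 -> \bar R})
    (Y1 : T1 -> R) (Y2 : T2 -> R) (X1 : T1 -> U) (X2 : T2 -> U)
    (phi : U -> \bar R) :
  measurable_fun setT Y1 -> (forall t, (0 <= Y1 t)%R) ->
  measurable_fun setT X1 ->
  measurable_fun setT Y2 -> (forall t, (0 <= Y2 t)%R) ->
  measurable_fun setT X2 ->
  (forall B, measurable B -> \int[mu1]_t (Y1 t * \1_B (X1 t))%:E =
                             \int[mu2]_t (Y2 t * \1_B (X2 t))%:E) ->
  measurable_fun setT phi -> (forall x, 0 <= phi x) ->
  \int[mu1]_t ((Y1 t)%:E * phi (X1 t)) = \int[mu2]_t ((Y2 t)%:E * phi (X2 t)).
Proof.
move=> mY1 Y10 mX1 mY2 Y20 mX2 h mphi phi0.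
rewrite (integral_weighted_comp mu1 mphi mY1 Y10 mX1 phi0).
rewrite (integral_weighted_comp mu2 mphi mY2 Y20 mX2 phi0).
congr (limn _); apply/funext => n; apply: eq_fsbigr => y _; congr (_ * _).
exact: h.
Qed.

End weighted_law.

Section independence.
Context (R : realType) (dT : measure_display) (T : measurableType dT).
Context (P : probability T R) (D : set nat) (X : nat -> {RV P >-> R}).
Hypothesis indepX : mutually_independent D X.
Local Open Scope ereal_scope.

Let integral_prod_indic_comp (s : seq nat) (B : nat -> set R) : uniq s ->
  (forall i, i \in s -> D i) -> (forall i, measurable (B i)) ->
  \int[P]_t (\prod_(i <- s) \1_(B i) (X i t))%:E =
  \prod_(i <- s) \int[P]_t (\1_(B i) (X i t))%:E.
Proof.
move=> us sD mB.
have mXB i : measurable (X i @^-1` B i).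
  by rewrite -[X in measurable X]setTI; exact: measurable_funPT.
have e1 i : \int[P]_t (\1_(B i) (X i t))%:E = P (X i @^-1` B i).
  transitivity (\int[P]_t (\1_(X i @^-1` B i) t)%:E); first by [].
  by rewrite integral_indic// setIT.
under [RHS]eq_bigr do rewrite e1.
have pJ : perm_eq s [fset i in s]%fset.
  by apply: uniq_perm; [|exact: fset_uniq|move=> i; rewrite !inE].
rewrite [RHS](perm_big _ pJ)/= -indepX//; last first.
  by move=> i /=; rewrite !inE => /sD.
have mcap : measurable (\bigcap_(i in [set` [fset i in s]%fset]) (X i @^-1` B i)).
  by apply: fin_bigcap_measurable => // i _; exact: mXB.
rewrite -[X in P X]setIT -integral_indic//.
apply: eq_integral => t _; congr EFin.
rewrite [RHS]indicE.
have [tB|tB] := boolP (t \in _).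
  rewrite big_seq big1// => i si; rewrite indicE mem_set//.
  by move/set_mem : tB; apply; rewrite /= !inE.
have : exists2 i, i \in s & ~ B i (X i t).
  apply: contrapT => h; move/negP: tB; apply; apply/mem_set => i /=.
  rewrite !inE => si; apply: contrapT => Bi; apply: h; exists i => //.
by case=> i si Bi; rewrite (big_rem i)//= indicE memNset// mul0r.
Qed.

(* The indicators of the definition of independence are replaced by the [phi i]
   one at a time: in the induction, the factors of [s2] are still indicators. *)
Lemma integral_prod_independent (s : seq nat) (phi : nat -> R -> R) :
  uniq s -> (forall i, i \in s -> D i) ->
  (forall i, measurable_fun setT (phi i)) ->
  (forall i x, (0 <= phi i x <= 1)%R) ->
  \int[P]_t (\prod_(i <- s) phi i (X i t))%:E =
  \prod_(i <- s) \int[P]_t (phi i (X i t))%:E.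
Proof.
move=> us sD mphi phi01.
suff : forall (s1 s2 : seq nat) (phi : nat -> R -> R), uniq (s1 ++ s2) ->
  (forall i, i \in s1 ++ s2 -> D i) ->
  (forall i, measurable_fun setT (phi i)) ->
  (forall i x, (0 <= phi i x <= 1)%R) ->
  (forall i, i \in s2 -> exists2 B, measurable B & phi i = \1_B) ->
  \int[P]_t (\prod_(i <- s1 ++ s2) phi i (X i t))%:E =
  \prod_(i <- s1 ++ s2) \int[P]_t (phi i (X i t))%:E.
  by move=> /(_ s [::] phi); rewrite cats0; apply.
move=> {us sD mphi phi01 s phi}.
elim=> [|k s1 IH] s2 phi us sD mphi phi01 ind.
  (* Independence asks for a measurable set at every index, hence the default [set0] where [phi i]
     is no indicator. *)
  pose B i := if pselect (exists2 B, measurable B & phi i = \1_B) is left h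
              then sval (cid2 h) else set0.
  have mB i : measurable (B i).
    by rewrite /B; case: pselect => // h; case: cid2.
  have phiB i : i \in s2 -> phi i = \1_(B i).
    by move=> /ind h; rewrite /B; case: pselect => // h'; case: cid2.
  rewrite /= in us sD *.
  rewrite (eq_big_seq (fun i => \int[P]_t (\1_(B i) (X i t))%:E)); last first.
    by move=> i /phiB ->.
  rewrite -integral_prod_indic_comp//; apply: eq_integral => t _; congr EFin.
  by apply: eq_big_seq => i /phiB ->.
have [kNs us'] : k \notin s1 ++ s2 /\ uniq (s1 ++ s2).
  by move: us; rewrite cat_cons cons_uniq => /andP.
set Y := fun t => (\prod_(i <- s1 ++ s2) phi i (X i t))%R.
set c := \prod_(i <- s1 ++ s2) \int[P]_t (phi i (X i t))%:E.
have mphiX i : measurable_fun setT (fun t => phi i (X i t)).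
  exact: measurableT_comp.
have phiX0 i t : (0 <= phi i (X i t))%R by case/andP: (phi01 i (X i t)).
have intphi0 i : 0 <= \int[P]_t (phi i (X i t))%:E.
  by apply: integral_ge0 => t _; rewrite lee_fin.
have intphi1 i : \int[P]_t (phi i (X i t))%:E <= 1.
  rewrite -[leRHS](@probability_setT _ _ _ P) -[P _]mul1e -integral_cst//.
  apply: ge0_le_integral => //.
  - by move=> t _; rewrite lee_fin.
  - exact/measurable_EFinP.
  - by move=> t _; rewrite lee_fin; case/andP: (phi01 i (X i t)).
have c0 : 0 <= c by apply: prode_ge0.
(* Each factor is at most 1, so [c] is finite and can serve as a constant real weight. *)
have cfin : c \is a fin_num.
  rewrite /c; elim/big_ind: _ => // [x y ? ?|i _].
    by rewrite fin_numM.
  by rewrite ge0_fin_numE// (le_lt_trans (intphi1 i))// ltry.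
have mY : measurable_fun setT Y by apply: measurable_prod.
have Y0 t : (0 <= Y t)%R by apply: prodr_ge0.
have fc0 : (0 <= fine c)%R by rewrite fine_ge0.
rewrite cat_cons big_cons -/c.
transitivity (\int[P]_t ((Y t)%:E * (phi k (X k t))%:E)).
  by apply: eq_integral => t _; rewrite big_cons mulrC EFinM.
rewrite (@eq_integral_weighted_comp _ _ _ _ _ _ _ P P Y (fun=> fine c) (X k) (X k)
  (EFin \o phi k))//=.
- rewrite ge0_integralZl//= ?lee_fin//.
  + by rewrite fineK// muleC.
  + exact/measurable_EFinP.
  + by move=> t _; rewrite lee_fin.
- move=> B mB.
  (* With [phi k] replaced by an indicator, [k] may move from the general factors to the indicators,
     where the induction hypothesis applies. *)
  pose phi' i := if i == k then \1_B else phi i.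
  have phi'E i : i \in s1 ++ s2 -> phi' i = phi i.
    by move=> si; rewrite /phi'; case: eqP => // ik; rewrite -ik si in kNs.
  have phi'k : phi' k = \1_B by rewrite /phi' eqxx.
  have ps : perm_eq (s1 ++ k :: s2) (k :: s1 ++ s2).
    by rewrite -[k :: s2]cat1s perm_catCA.
  have indB x : (0 <= (\1_B x : R) <= 1)%R.
    by rewrite indicE; case: (x \in B); rewrite ?lexx ?ler01 ?lexx.
  transitivity (\int[P]_t (\1_B (X k t))%:E * c); last first.
    under [RHS]eq_integral do rewrite EFinM.
    rewrite ge0_integralZl//= ?lee_fin//.
      by rewrite fineK// muleC.
    exact/measurable_EFinP/(measurableT_comp (measurable_indic mB)).
  transitivity (\int[P]_t (\prod_(i <- s1 ++ k :: s2) phi' i (X i t))%:E).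
    apply: eq_integral => t _; rewrite (perm_big _ ps)/= big_cons phi'k mulrC.
    by congr (_ * _)%:E; apply: eq_big_seq => i /phi'E ->.
  rewrite IH.
  + rewrite (perm_big _ ps)/= big_cons phi'k; congr (_ * _).
    by apply: eq_big_seq => i /phi'E ->.
  + by rewrite (perm_uniq ps).
  + by move=> i; rewrite (perm_mem ps); exact: sD.
  + move=> i; rewrite /phi'; case: ifP => // _; exact: measurable_indic.
  + by move=> i x; rewrite /phi'; case: ifP.
  + move=> i; rewrite inE => /predU1P[->|si]; first by exists B.
    by rewrite phi'E ?mem_cat ?si ?orbT//; exact: ind.
- exact/measurable_EFinP.
- by move=> x; rewrite lee_fin; case/andP: (phi01 k x).
Qed.

End independence.

(** * Integration by parts on open intervals *)

(* Both integrals may be infinite. *)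
Lemma integral_eq_of_derive_vanishing (R : realType) (u w : nat -> R)
    (F f1 f2 : R -> R) :
  let D := \bigcup_k `[u k, w k]%classic in
  nondecreasing_seq (fun k => `[u k, w k]%classic) ->
  (forall k, u k < w k) ->
  (forall x, D x -> 0 <= f1 x) -> (forall x, D x -> 0 <= f2 x) ->
  (forall x, D x -> {for x, continuous f1}) ->
  (forall x, D x -> {for x, continuous f2}) ->
  (forall x, D x -> is_derive x 1 F (f1 x - f2 x)) ->
  F (u k) @[k --> \oo] --> 0 -> F (w k) @[k --> \oo] --> 0 ->
  (\int[@lebesgue_measure R]_(x in D) (f1 x)%:E =
   \int[@lebesgue_measure R]_(x in D) (f2 x)%:E)%E.
Proof.
move=> D ndS uw f10 f20 cf1 cf2 dF Fu Fw.
have SD k x : x \in `[u k, w k] -> D x by move=> xk; exists k.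
have cS (f : R -> R) k : (forall x, D x -> {for x, continuous f}) ->
    {within `[u k, w k], continuous f}.
  move=> cf; apply: continuous_in_subspaceT => x /set_mem xk.
  exact: cf (SD k x xk).
have mS (f : R -> R) k : (forall x, D x -> {for x, continuous f}) ->
    measurable_fun `[u k, w k] (EFin \o f).
  move=> /(cS _ k) cf; apply/measurable_EFinP.
  by apply: subspace_continuous_measurable_fun.
have cvgS (f : R -> R) : (forall x, D x -> 0 <= f x) ->
    (forall x, D x -> {for x, continuous f}) ->
    (\int[@lebesgue_measure R]_(x in `[u k, w k]) (f x)%:E @[k --> \oo] -->
     \int[@lebesgue_measure R]_(x in D) (f x)%:E)%E.
  move=> f0 cf; apply: ge0_nondecreasing_set_cvg_integral => //.
  - by move=> k; exact: mS.
  - by move=> k x xk; rewrite lee_fin; apply/f0/(SD k).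
(* On a compact segment both integrals are finite and can be subtracted; on [D] the difference might
   be undefined. Monotone convergence then passes to [D]. *)
have ibp k : (\int[@lebesgue_measure R]_(x in `[u k, w k]) (f1 x)%:E =
    (F (w k) - F (u k))%:E + 
    \int[@lebesgue_measure R]_(x in `[u k, w k]) (f2 x)%:E)%E.
  have i1 : (@lebesgue_measure R).-integrable `[u k, w k] (EFin \o f1).
    by apply: continuous_compact_integrable; [exact: segment_compact|exact: cS].
  have i2 : (@lebesgue_measure R).-integrable `[u k, w k] (EFin \o f2).
    by apply: continuous_compact_integrable; [exact: segment_compact|exact: cS].
  have cF x : D x -> {for x, continuous F}.
    by move=> /dF [dFx _]; apply/differentiable_continuous/derivable1_diffP.
  rewrite EFinB -(@continuous_FTC2 _ (f1 \- f2) F (u k) (w k))//.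
  - rewrite [X in (X + _)%E](_ : _ =
      \int[@lebesgue_measure R]_(x in `[u k, w k]) ((f1 x)%:E - (f2 x)%:E))%E//.
    rewrite integralB// subeK//.
    exact: integrable_fin_num.
  - apply: cS => x Dx; apply: cvgB; [exact: cf1|exact: cf2].
  - have ukD : D (u k) by exists k => //=; rewrite in_itv/= lexx ltW.
    have wkD : D (w k) by exists k => //=; rewrite in_itv/= lexx ltW.
    split.
    + move=> x xk; have [] // := dF x _.
      by apply: (SD k); apply: subset_itv_oo_cc xk.
    + exact/cvg_at_right_filter/cF.
    + exact/cvg_at_left_filter/cF.
  - move=> x xk; rewrite derive1E; have [|_ ->] // := dF x _.
    by apply: (SD k); apply: subset_itv_oo_cc xk.
have l1 := cvgS _ f10 cf1; have l2 := cvgS _ f20 cf2.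
have := l1; under eq_fun do rewrite ibp; move=> {}l1.
rewrite -[RHS]add0e; apply: (cvg_unique _ l1) => //.
apply: cvgeD => //.
have h := cvgB Fw Fu; rewrite subr0 in h.
by apply: cvg_EFin; [exact: nearW|exact: h].
Qed.

Section derivatives.
Variable R : realType.
Implicit Types a b t x : R.

Lemma is_derive_continuous (f : R -> R) t l :
  is_derive t 1 f l -> {for t, continuous f}.
Proof. by case=> ft _; apply/differentiable_continuous/derivable1_diffP. Qed.

Lemma is_derive_expRN t : is_derive t 1 (fun t => expR (- t)) (- expR (- t)).
Proof.
have -> : - expR (- t) = expR (- t) * - 1 by rewrite mulrN1.
by apply: is_derive1_comp.
Qed.

Lemma is_derive_powR_onem b t : t < 1 ->
  is_derive t 1 (fun t => (1 - t) `^ b) (- (b * (1 - t) `^ (b - 1))).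
Proof.
move=> t1; rewrite -[X in is_derive _ _ _ X]mulrN1.
have h : is_derive (1 - t) 1 (@powR R ^~ b) (b * (1 - t) `^ (b - 1)).
  by apply: is_derive1_powR; rewrite subr_gt0.
apply: (@is_derive1_comp R (@powR R ^~ b) (fun t => 1 - t)).
by have := is_deriveB (is_derive_cst (1 : R) t 1) (is_derive_id t 1); rewrite sub0r.
Qed.

Lemma is_derive_mul (f g : R -> R) t df dg : is_derive t 1 f df ->
  is_derive t 1 g dg -> is_derive t 1 (fun t => f t * g t) (f t * dg + g t * df).
Proof. by move=> hf hg; apply: is_deriveM. Qed.

(** Half of the exponential absorbs the power. The other half gives both the vanishing at infinity
    and the integrability needed for Gamma. *)
Lemma powR_expRN_le x t : 0 < x -> 0 < t ->
  t `^ x * expR (- t) <= (2 * x) `^ x * expR (- (t / 2)).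
Proof.
move=> x0 t0.
have -> : - (t / 2) = t / 2 - t by lra.
rewrite expRD mulrA ler_wpM2r ?expR_ge0//.
(* [1 + y <= expR y] at [y = t / (2 * x)] *)
have tE : t = 2 * x * (t / (2 * x)) by rewrite mulrC divfK// mulf_neq0// gt_eqF.
rewrite {1}tE powRM ?ler_wpM2l ?powR_ge0//; last 2 first.
- by rewrite mulr_ge0// ltW.
- by rewrite divr_ge0 ?mulr_ge0// ltW.
have -> : t / 2 = t / (2 * x) * x by rewrite invfM mulrA divfK// gt_eqF.
rewrite expRM ge0_ler_powR ?nnegrE ?(ltW x0) ?expR_ge0//.
- by rewrite divr_ge0 ?mulr_ge0// ltW.
- by rewrite (le_trans _ (expR_ge1Dx _))// lerDr.
Qed.

Lemma expRN_le_inv t : 0 < t -> expR (- t) <= t^-1.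
Proof.
move=> t0; rewrite expRN lef_pV2 ?posrE ?expR_gt0//.
by rewrite (le_trans _ (expR_ge1Dx _))// lerDr.
Qed.

Lemma powR_expRN_cvg0 x : 0 < x ->
  k.+2%:R `^ x * expR (- k.+2%:R) @[k --> \oo] --> (0 : R).
Proof.
move=> x0.
apply: (@squeeze_cvgr _ _ _ _ (fun=> 0) (fun k => (2 * x) `^ x * 2 * harmonic k.+1)).
- apply: nearW => k; rewrite mulr_ge0 ?powR_ge0 ?expR_ge0//=.
  rewrite (le_trans (powR_expRN_le x0 _))// -mulrA ler_wpM2l ?powR_ge0//.
  by rewrite (le_trans (expRN_le_inv _))// invf_div.
- exact: cvg_cst.
- rewrite -[X in _ --> X](mulr0 ((2 * x) `^ x * 2)); apply: cvgMr.
  by rewrite (cvg_shiftS (@harmonic R)); exact: cvg_harmonic.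
Qed.

Lemma cvg_inv_natD0 m : (k + m).+1%:R^-1 @[k --> \oo] --> (0 : R).
Proof. by rewrite (cvg_shiftn m (@harmonic R)); exact: cvg_harmonic. Qed.
End derivatives.

(** * The Gamma function *)

Section gamma.
Variable R : realType.
Implicit Types t x : R.
Notation mu := (@lebesgue_measure R).

(** The extended-real integral of which [Gamma x] is the finite part: here divergence is +oo and not
    0. *)
Definition gamma_integral x : \bar R :=
  (\int[mu]_(t in `]0%R, +oo[) (t `^ (x - 1) * expR (- t))%:E)%E.

(** The shift by 2 keeps even the segment of index 0 nondegenerate. *)
Lemma bigcup_itv_inv :
  \bigcup_k `[k.+2%:R^-1, k.+2%:R]%classic = `]0, +oo[%classic :> set R.
Proof.
apply/seteqP; split => t /=.
  by case=> k _; rewrite /= !in_itv/= andbT => /andP[+ _]; apply: lt_le_trans.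
rewrite in_itv/= andbT => t0.
have [it0 ti] := (@archi_boundP _ t^-1, @archi_boundP _ t).
have {}it0 := it0 (ltW (etrans (invr_gt0 t) t0)); have {}ti := ti (ltW t0).
exists (Num.bound t + Num.bound t^-1)%N => //=; rewrite in_itv/=; apply/andP; split.
  rewrite -[leRHS]invrK lef_pV2 ?posrE ?invr_gt0// (le_trans (ltW it0))//.
  by rewrite ler_nat; lia.
by rewrite (le_trans (ltW ti))// ler_nat; lia.
Qed.

Lemma continuous_powR_expRN x t : 0 < t ->
  {for t, continuous (fun t => t `^ x * expR (- t))}.
Proof.
move=> t0; apply: is_derive_continuous.
apply: is_derive_mul (is_derive_expRN t); exact: is_derive1_powR.
Qed.

Lemma measurable_powR_expRN x :
  measurable_fun (`]0, +oo[%classic : set R) (fun t => t `^ x * expR (- t)).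
Proof.
apply: open_continuous_measurable_fun => //.
move=> t; rewrite inE/= in_itv/= andbT; exact: continuous_powR_expRN.
Qed.

Lemma powR_expRN_ge0 x t : 0 <= t `^ x * expR (- t).
Proof. by rewrite mulr_ge0 ?powR_ge0 ?expR_ge0. Qed.

(** Integration by parts with t^x e^(-t), which vanishes at both ends because x > 0. Finiteness is
    not presupposed, as it will be deduced from this equation. *)
Lemma gamma_integralS x : 0 < x ->
  gamma_integral (x + 1) = (x%:E * gamma_integral x)%E.
Proof.
move=> x0; rewrite /gamma_integral addrK -ge0_integralZl//=; last 3 first.
- by apply/measurable_EFinP; exact: measurable_powR_expRN.
- by move=> t _; rewrite lee_fin powR_expRN_ge0.
- by rewrite lee_fin ltW.
pose F t := t `^ x * expR (- t).
rewrite -bigcup_itv_inv; apply/esym.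
apply: (@integral_eq_of_derive_vanishing _ _ _ F
  (fun t => x * (t `^ (x - 1) * expR (- t))) F).
- move=> m n mn; apply/subsetPset; apply: subset_itv; rewrite bnd_simp.
    by rewrite lef_pV2 ?posrE// ler_nat !ltnS.
  by rewrite ler_nat !ltnS.
- by move=> k; rewrite (@lt_trans _ _ 1)// ?invf_lt1 ?ltr1n// ltr0n.
- by move=> t _; rewrite mulr_ge0 ?powR_expRN_ge0// ltW.
- by move=> t _; exact: powR_expRN_ge0.
- move=> t; rewrite bigcup_itv_inv/= in_itv/= andbT => t0.
  by apply: cvgMr; exact: continuous_powR_expRN.
- move=> t; rewrite bigcup_itv_inv/= in_itv/= andbT; exact: continuous_powR_expRN.
- move=> t; rewrite bigcup_itv_inv/= in_itv/= andbT => t0.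
  have := is_derive_mul (is_derive1_powR x t0) (is_derive_expRN t).
  by congr (is_derive _ _ _ _); rewrite /F; ring.
- rewrite -(mul0r (expR (- 0))); apply: cvgM.
    apply: ((cvg_at_rightP _ _ _).1 (powR_cvg0 x0)); split => //.
    by have := @cvg_inv_natD0 R 1; under eq_fun do rewrite addn1.
  have h : - (k.+2%:R^-1) @[k --> \oo] --> (- 0 : R).
    by apply: cvgN; have := @cvg_inv_natD0 R 1; under eq_fun do rewrite addn1.
  exact: (cvg_comp _ _ h (@continuous_expR R (- 0))).
- exact: powR_expRN_cvg0.
Qed.

Lemma gamma_integral_ge0 x : (0 <= gamma_integral x)%E.
Proof. by apply: integral_ge0 => t _; rewrite lee_fin powR_expRN_ge0. Qed.

Lemma gamma_integral_lty x : 0 < x -> (gamma_integral x < +oo)%E.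
Proof.
move=> x0.
(* At x + 1 the integrand is bounded near 0, so only the tail has to be controlled. *)
suff : (gamma_integral (x + 1) < +oo)%E.
  rewrite gamma_integralS//.
  by case: (gamma_integral x) => [r||]//; rewrite ?ltry ?ltNyr// gt0_muley ?lte_fin.
(* The bound (2x)^x e^(-t/2) is (2x)^x * 2 times the exponential density of rate 1/2, whose integral
   is 1. *)
pose e := exponential_pdf (2^-1 : R).
have me : measurable_fun setT (fun t => ((2 * x) `^ x * 2 * e t)%:E).
  by apply/measurable_EFinP/measurable_funM => //; exact: measurable_exponential_pdf.
have e0 t : (0 <= ((2 * x) `^ x * 2 * e t)%:E)%E.
  by rewrite lee_fin mulr_ge0 ?mulr_ge0 ?powR_ge0// exponential_pdf_ge0.
have : (gamma_integral (x + 1) <= \int[mu]_t ((2 * x) `^ x * 2 * e t)%:E)%E.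
  apply: (@le_trans _ _ (\int[mu]_(t in `]0%R, +oo[) ((2 * x) `^ x * 2 * e t)%:E)%E).
    apply: ge0_le_integral => //.
    - by move=> t _; rewrite lee_fin powR_expRN_ge0.
    - by apply/measurable_EFinP; exact: measurable_powR_expRN.
    - exact: measurable_funS me.
    - move=> t /=; rewrite in_itv/= andbT => t0; rewrite lee_fin addrK.
      rewrite (le_trans (powR_expRN_le x0 t0))// /e exponential_pdfE ?(ltW t0)//.
      by rewrite -!mulrA mulVKf ?pnatr_eq0// mulNr (mulrC t).
  exact: ge0_subset_integral.
move/le_lt_trans; apply.
under eq_integral do rewrite EFinM.
rewrite ge0_integralZl//=.
- by rewrite integral_exponential_pdf// mule1 ltry.
- by apply/measurable_EFinP; exact: measurable_exponential_pdf.
- by move=> t _; rewrite lee_fin exponential_pdf_ge0.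
- by rewrite lee_fin mulr_ge0 ?powR_ge0.
Qed.

Lemma Gamma_gt0 x : 0 < x -> 0 < Gamma x.
Proof.
move=> x0; apply: fine_gt0; rewrite -/(gamma_integral x) gamma_integral_lty// andbT.
(* At x + 1 the power is t^x, at least 1 on ]1, 2[ for every x > 0, so the integrand is at least
   e^(-2) there. *)
suff : (0 < gamma_integral (x + 1))%E.
  rewrite gamma_integralS// !lt_neqAle gamma_integral_ge0 andbT => /andP[+ _].
  by apply: contraNN => /eqP <-; rewrite mule0.
apply: (@lt_le_trans _ _ (\int[mu]_(t in `]1%R, 2%R[) (expR (- 2))%:E)%E).
  rewrite integral_cst//= lebesgue_measure_itv/= lte_fin ltr1n -EFinB -EFinM lte_fin.
  by rewrite mulr_gt0 ?expR_gt0// subr_gt0 ltr1n.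
apply: (@le_trans _ _
  (\int[mu]_(t in `]1%R, 2%R[) (t `^ (x + 1 - 1) * expR (- t))%:E)%E).
  apply: ge0_le_integral => //.
  - apply/measurable_EFinP.
    apply: (measurable_funS _ _ (@measurable_powR_expRN (x + 1 - 1))) => //.
    by apply: subset_itv; rewrite bnd_simp.
  - move=> t /=; rewrite in_itv/= => /andP[t1 t2]; rewrite lee_fin addrK.
    rewrite -[leLHS]mul1r ler_pM ?expR_ge0// ?ler_expR ?lerN2 ?(ltW t2)//.
    by rewrite -(powRr0 t) ler_powR ?ltW.
apply: ge0_subset_integral => //.
- by apply/measurable_EFinP; exact: measurable_powR_expRN.
- by move=> t _; rewrite lee_fin powR_expRN_ge0.
- by apply: subset_itv; rewrite bnd_simp.
Qed.

Lemma GammaS x : 0 < x -> Gamma (x + 1) = x * Gamma x.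
Proof.
move=> x0; rewrite /Gamma /Rintegral -/(gamma_integral _) -/(gamma_integral _).
by rewrite gamma_integralS// fineM// ge0_fin_numE ?gamma_integral_ge0//
  gamma_integral_lty.
Qed.

Lemma Gamma_natD x m : 0 < x -> Gamma (m%:R + x) = rising x m * Gamma x.
Proof.
move=> x0; elim: m => [|m IH]; first by rewrite /rising big_nil add0r mul1r.
rewrite -natr1 -addrA (addrC 1) addrA GammaS; last by rewrite ltr_wpDl.
by rewrite IH /rising big_nat_recr//= (addrC m%:R); ring.
Qed.
End gamma.

(** * The Beta function *)

Section beta.
Variable R : realType.
Implicit Types a b t : R.
Notation mu := (@lebesgue_measure R).

Definition beta_integral a b : \bar R :=
  (\int[mu]_(t in `]0%R, 1%R[) (t `^ (a - 1) * (1 - t) `^ (b - 1))%:E)%E.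

(** The shift by 3 makes the segment of index 0 equal to [1/3, 2/3]; a shift by 2 would reduce it to
    a point. *)
Lemma bigcup_itv_inv_onem :
  \bigcup_k `[k.+3%:R^-1, 1 - k.+3%:R^-1]%classic = `]0, 1[%classic :> set R.
Proof.
have inv_bound t k : 0 < t -> (Num.bound t^-1 <= k)%N -> k.+3%:R^-1 <= t.
  move=> t0 tk; rewrite -[leRHS]invrK lef_pV2 ?posrE ?invr_gt0//.
  have /(_ _)/ltW := @archi_boundP _ t^-1.
  by rewrite invr_ge0 (ltW t0) => /(_ isT)/le_trans; apply; rewrite ler_nat; lia.
apply/seteqP; split => t /=.
  case=> k _; rewrite /= !in_itv/= => /andP[kt tk].
  by rewrite (lt_le_trans _ kt)//= (le_lt_trans tk)// ltrBlDr ltrDl.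
rewrite in_itv/= => /andP[t0 t1].
exists (Num.bound t^-1 + Num.bound (1 - t)^-1)%N => //=; rewrite in_itv/=.
rewrite inv_bound ?leq_addr//= lerBrDr -lerBrDl inv_bound ?subr_gt0 ?leq_addl//.
Qed.

Lemma is_derive_beta_kernel a b t : 0 < t < 1 ->
  is_derive t 1 (fun t => t `^ a * (1 - t) `^ b)
    (a * (t `^ (a - 1) * (1 - t) `^ b) - b * (t `^ a * (1 - t) `^ (b - 1))).
Proof.
case/andP=> t0 t1.
have := is_derive_mul (is_derive1_powR a t0) (is_derive_powR_onem b t1).
by congr (is_derive _ _ _ _); ring.
Qed.

Lemma continuous_beta_kernel a b t : 0 < t < 1 ->
  {for t, continuous (fun t => t `^ a * (1 - t) `^ b)}.
Proof.
by move=> t01; exact: is_derive_continuous (is_derive_beta_kernel a b t01).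
Qed.

Lemma measurable_beta_kernel a b :
  measurable_fun (`]0, 1[%classic : set R) (fun t => t `^ a * (1 - t) `^ b).
Proof.
apply: open_continuous_measurable_fun => //.
move=> t; rewrite inE/= in_itv/=; exact: continuous_beta_kernel.
Qed.

Lemma beta_kernel_ge0 a b t : 0 <= t `^ a * (1 - t) `^ b.
Proof. by rewrite mulr_ge0 ?powR_ge0. Qed.

Lemma beta_integral_ge0 a b : (0 <= beta_integral a b)%E.
Proof. by apply: integral_ge0 => t _; rewrite lee_fin beta_kernel_ge0. Qed.

Lemma EFin_Beta a b : (beta_integral a b < +oo)%E ->
  beta_integral a b = (Beta a b)%:E.
Proof.
move=> h; rewrite /Beta /Rintegral -/(beta_integral a b) fineK//.
by rewrite ge0_fin_numE// beta_integral_ge0.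
Qed.

(** Insert 1 = t + (1 - t) in the integrand. *)
Lemma beta_integral_split a b : 0 < a -> 0 < b ->
  (beta_integral a b = beta_integral (a + 1) b + beta_integral a (b + 1))%E.
Proof.
move=> a0 b0; rewrite /beta_integral -ge0_integralD//=.
- apply: eq_integral => t; rewrite inE/= in_itv/= => /andP[t0 t1].
  rewrite -EFinD !addrK -(mulr_powRB1 (ltW t0) a0).
  rewrite -(@mulr_powRB1 _ (1 - t) b) ?subr_ge0 ?ltW//.
  by congr (_ %:E); ring.
- by move=> t _; rewrite lee_fin beta_kernel_ge0.
- by apply/measurable_EFinP; exact: measurable_beta_kernel.
- by move=> t _; rewrite lee_fin beta_kernel_ge0.
- by apply/measurable_EFinP; exact: measurable_beta_kernel.
Qed.

(** The function t^a (1 - t)^b vanishes at 0 and at 1, and its derivative is the difference of the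
    two integrands. *)
Lemma beta_integral_by_parts a b : 0 < a -> 0 < b ->
  (b%:E * beta_integral (a + 1) b = a%:E * beta_integral a (b + 1))%E.
Proof.
move=> a0 b0; rewrite /beta_integral !addrK -!ge0_integralZl//=; last 6 first.
- by apply/measurable_EFinP; exact: measurable_beta_kernel.
- by move=> t _; rewrite lee_fin beta_kernel_ge0.
- by rewrite lee_fin ltW.
- by apply/measurable_EFinP; exact: measurable_beta_kernel.
- by move=> t _; rewrite lee_fin beta_kernel_ge0.
- by rewrite lee_fin ltW.
rewrite -bigcup_itv_inv_onem; apply/esym.
have cvgu : k.+3%:R^-1 @[k --> \oo] --> (0 : R).
  by have := @cvg_inv_natD0 R 2; under eq_fun do rewrite addn2.
have inv0 k : 0 < (k.+3%:R^-1 : R) by rewrite invr_gt0.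
have cvg1 (c : R) : 0 < c -> (1 - k.+3%:R^-1) `^ c @[k --> \oo] --> (1 : R).
  move=> c0.
  have h : 1 - k.+3%:R^-1 @[k --> \oo] --> (1 - 0 : R).
    by apply: cvgB => //; exact: cvg_cst.
  rewrite subr0 in h; rewrite -[X in _ --> X](congr1 (fun f => f c) (@powR1 R)).
  exact: (cvg_comp _ _ h (is_derive_continuous (is_derive1_powR c (@ltr01 R)))).
have cvg0 (c : R) : 0 < c -> (k.+3%:R^-1) `^ c @[k --> \oo] --> (0 : R).
  by move=> c0; apply: ((cvg_at_rightP _ _ _).1 (powR_cvg0 c0)); split.
apply: (@integral_eq_of_derive_vanishing _ _ _ (fun t => t `^ a * (1 - t) `^ b)
  (fun t => a * (t `^ (a - 1) * (1 - t) `^ b))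
  (fun t => b * (t `^ a * (1 - t) `^ (b - 1)))).
- by move=> m n mn; apply/subsetPset; apply: subset_itv; rewrite bnd_simp ?lerB//
    lef_pV2 ?posrE// ler_nat !ltnS.
- move=> k; have : (k.+3%:R^-1 : R) < 2^-1 by rewrite ltf_pV2 ?posrE// ltr_nat.
  by move: (_^-1) => u; lra.
- by move=> t _; rewrite mulr_ge0 ?beta_kernel_ge0// ltW.
- by move=> t _; rewrite mulr_ge0 ?beta_kernel_ge0// ltW.
- move=> t; rewrite bigcup_itv_inv_onem/= in_itv/= => t01.
  by apply: cvgMr; exact: continuous_beta_kernel.
- move=> t; rewrite bigcup_itv_inv_onem/= in_itv/= => t01.
  by apply: cvgMr; exact: continuous_beta_kernel.
- move=> t; rewrite bigcup_itv_inv_onem/= in_itv/=; exact: is_derive_beta_kernel.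
- by rewrite -[X in _ --> X](mul0r 1); apply: cvgM; [exact: cvg0|exact: cvg1].
- rewrite -[X in _ --> X](mulr0 1); apply: cvgM; first exact: cvg1.
  by under eq_fun do rewrite subKr; exact: cvg0.
Qed.

Lemma beta_integral_lty_shift a b : 0 < a -> 0 < b -> (beta_integral a b < +oo)%E ->
  (beta_integral (a + 1) b < +oo)%E /\ (beta_integral a (b + 1) < +oo)%E.
Proof.
move=> a0 b0; rewrite beta_integral_split// => h; split; apply: le_lt_trans h.
  by rewrite leeDl// beta_integral_ge0.
by rewrite leeDr// beta_integral_ge0.
Qed.

(** The splitting and the integration by parts are two linear equations in [Beta (a + 1) b] and
    [Beta a (b + 1)]; this is their solution. *)
Lemma Beta_shift a b : 0 < a -> 0 < b -> (beta_integral a b < +oo)%E ->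
  Beta (a + 1) b = a / (a + b) * Beta a b /\
  Beta a (b + 1) = b / (a + b) * Beta a b.
Proof.
move=> a0 b0 h; have [h1 h2] := beta_integral_lty_shift a0 b0 h.
have := beta_integral_split a0 b0; have := beta_integral_by_parts a0 b0.
rewrite (EFin_Beta h) (EFin_Beta h1) (EFin_Beta h2) -EFinD -!EFinM => -[e1] [e2].
have [aN0 bN0 abN0] : [/\ a != 0, b != 0 & a + b != 0].
  by rewrite !gt_eqF ?addr_gt0.
split; rewrite e2.
- have -> : Beta a (b + 1) = b * Beta (a + 1) b / a by rewrite e1; field.
  by field; rewrite aN0.
- have -> : Beta (a + 1) b = a * Beta a (b + 1) / b by rewrite -e1; field.
  by field; rewrite bN0.
Qed.

(** The parameters are raised by one unit at a time. Finiteness is carried along because each single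
    shift requires it. *)
Lemma Beta_natD a b e f : 0 < a -> 0 < b -> (beta_integral a b < +oo)%E ->
  (beta_integral (a + e%:R) (b + f%:R) < +oo)%E /\
  Beta (a + e%:R) (b + f%:R) =
    rising a e * rising b f / rising (a + b) (e + f) * Beta a b.
Proof.
move=> a0 b0 h.
have rising0 x : rising x 0 = 1 by rewrite /rising big_nil.
have risingS x m : rising x m.+1 = rising x m * (x + m%:R).
  by rewrite /rising big_nat_recr.
have abp m : 0 < a + b + m%:R by rewrite ltr_wpDr// addr_gt0.
have rp m : rising (a + b) m != 0.
  by rewrite gt_eqF// prodr_gt0.
elim: f => [|f [IH1 IH2]].
  elim: e => [|e [IH1 IH2]]; first by rewrite !rising0 !addr0; split=> //; field.
  have ae : 0 < a + e%:R by rewrite ltr_wpDr.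
  have bf : 0 < b + 0%:R by rewrite addr0.
  rewrite -natr1 addrA; split; first by have [] := beta_integral_lty_shift ae bf IH1.
  have [-> _] := Beta_shift ae bf IH1; rewrite IH2 !addn0 !risingS rising0.
  rewrite (_ : a + e%:R + (b + 0%:R) = a + b + e%:R); last by ring.
  by field; rewrite rp gt_eqF.
have ae : 0 < a + e%:R by rewrite ltr_wpDr.
have bf : 0 < b + f%:R by rewrite ltr_wpDr.
rewrite -natr1 addrA; split; first by have [] := beta_integral_lty_shift ae bf IH1.
have [_ ->] := Beta_shift ae bf IH1; rewrite IH2 addnS !risingS natrD.
have := abp (e + f)%N; rewrite natrD => abef.
rewrite (_ : a + e%:R + (b + f%:R) = a + b + (e%:R + f%:R)); last by ring.
by field; rewrite rp gt_eqF.
Qed.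
End beta.

(** * Counting labels *)

Section counting.
Variables (n : nat) (z : 'I_n -> nat).
Hypothesis z_gt0 : forall i, (1 <= z i)%N.

Definition level_count (j : nat) : nat := #|[set i : 'I_n | z i == j]%SET|.

Lemma ltn_max_label i : (z i < (max_label z).+1)%N.
Proof. by rewrite ltnS /max_label (leq_bigmax i). Qed.

Lemma prod_max_label (R : comNzRingType) (F : nat -> R) :
  \prod_(i < n) F (z i) =
  \prod_(1 <= j < (max_label z).+1) \prod_(i < n | z i == j) F j.
Proof.
rewrite (exchange_big_dep xpredT)//=; apply: eq_bigr => i _.
rewrite big_mkcond (bigD1_seq (z i))//=; last 2 first.
- by rewrite mem_index_iota z_gt0 ltn_max_label.
- exact: iota_uniq.
by rewrite eqxx big1 ?mulr1// => j; rewrite eq_sym => /negPf ->.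
Qed.

Lemma count_ge_level j : count_ge z j = (level_count j + count_ge z j.+1)%N.
Proof.
rewrite /count_ge /level_count -cardsUI.
rewrite [X in (_ + X)%N]eq_card0 ?addn0; last by move=> i; rewrite !inE; lia.
by apply: eq_card => i; rewrite !inE; lia.
Qed.

Lemma count_ge1 : count_ge z 1 = n.
Proof.
by rewrite /count_ge -[RHS]card_ord -cardsT; apply: eq_card => i; rewrite !inE z_gt0.
Qed.

Lemma count_ge_max : count_ge z (max_label z).+1 = 0%N.
Proof.
apply/eqP; rewrite cards_eq0; apply/eqP/setP => i.
by rewrite !inE leqNgt ltn_max_label.
Qed.

(** The factor [1 - v j t] occurs in the weight of label [z i] exactly when [j < z i], hence the
    index [j.+1] in the exponent. *)
Lemma prod_stick_breaking (R : realType) (T : Type) (v : nat -> T -> R) t :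
  \prod_(i < n) stick_breaking v (z i) t =
  \prod_(1 <= j < (max_label z).+1)
    (v j t ^+ level_count j * (1 - v j t) ^+ count_ge z j.+1).
Proof.
rewrite /stick_breaking !big_split/=; congr (_ * _).
  rewrite (prod_max_label (fun j => v j t)); apply: eq_bigr => j _.
  rewrite prodr_const /level_count; congr (_ ^+ _).
  by apply: eq_card => i; rewrite !inE.
(* A range common to all [i], with the bound [j < z i] turned into a condition, lets the two
   products be exchanged. *)
transitivity (\prod_(i < n)
    \prod_(1 <= j < (max_label z).+1 | (j < z i)%N) (1 - v j t)).
  apply: eq_bigr => i _.
  by rewrite (big_nat_widen _ _ (max_label z).+1)// ltnW// ltn_max_label.
rewrite (exchange_big_dep xpredT)//=; apply: eq_bigr => j _.
rewrite prodr_const /count_ge; congr (_ ^+ _).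
by apply: eq_card => i; rewrite !inE.
Qed.

(** Blocks correspond to the labels that occur; the condition on [f 0] makes the missing labels
    harmless. *)
Lemma prod_level_blocks (R : comNzRingType) (f : nat -> R) : f 0%N = 1 ->
  \prod_(c in level_blocks z) f #|c| =
  \prod_(1 <= j < (max_label z).+1) f (level_count j).
Proof.
move=> f0.
pose m := max_label z.
pose B (j : 'I_m.+1) := [set i | z i == j]%SET.
pose J := [set j | B j != finset.set0]%SET.
have -> : level_blocks z = (B @: J)%SET.
  apply/setP => c; apply/imsetP/imsetP.
    case=> i _ ->; exists (Ordinal (ltn_max_label i)).
      by rewrite inE; apply/set0Pn; exists i; rewrite inE/=.
    by apply/setP => k; rewrite !inE/= eq_sym.
  case=> j; rewrite inE => /set0Pn[i]; rewrite inE => /eqP zi ->.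
  by exists i => //; apply/setP => k; rewrite !inE/= zi eq_sym.
rewrite big_imset/=; last first.
  move=> j k; rewrite !inE => /set0Pn[i]; rewrite inE => /eqP zi _ Bjk.
  have : i \in B k by rewrite -Bjk inE zi.
  by rewrite inE zi => /eqP /val_inj.
(* The ordinals indexing [B] start at 0, a label that never occurs and so contributes [f 0 = 1]. *)
rewrite [RHS](_ : _ = \prod_(0 <= j < m.+1) f (level_count j)); last first.
  rewrite [RHS]big_nat_recl// big_add1/= (_ : level_count 0 = 0%N) ?f0 ?mul1r//.
  by apply: eq_card0 => i; rewrite !inE; apply/negbTE; rewrite -lt0n z_gt0.
rewrite big_mkord [RHS](bigID (mem J))/= [X in _ * X]big1 ?mulr1//.
move=> j; rewrite inE negbK => /eqP Bj.
by rewrite /level_count [X in f X](_ : _ = #|B j|)// Bj cards0 f0.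
Qed.
End counting.

(** * Rising factorials and moments of Beta laws *)

Lemma rising_shift (R : realType) (x : R) m :
  rising (x + 1) m * x = rising x m * (m%:R + x).
Proof.
rewrite /rising; elim: m => [|m IH]; first by rewrite !big_nil add0r.
rewrite !big_nat_recr//= mulrAC IH -natr1; ring.
Qed.

(* With [rising (alpha + 1)] instead of [rising alpha], this also holds at
   [alpha = 0]. *)
Lemma prod_rising_telescope (R : realType) (d alpha : R) (g : nat -> nat) M :
  0 < d -> - d < alpha -> (0 < M)%N -> g M.+1 = 0%N ->
  \prod_(1 <= j < M.+1) (rising (alpha + j%:R * d) (g j.+1) /
                         rising (1 - d + (alpha + j%:R * d)) (g j)) =
  (rising (alpha + 1) (g 1%N))^-1 *
  \prod_(2 <= j < M.+1) ((alpha + (j%:R - 1) * d) /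
                         ((g j)%:R + alpha + (j%:R - 1) * d)).
Proof.
move=> d0 ad M0 gM.
(* For the induction, the last numerator is kept pending; it becomes 1 once [g M.+1 = 0]. *)
suff h : \prod_(1 <= j < M.+1) (rising (alpha + j%:R * d) (g j.+1) /
                         rising (1 - d + (alpha + j%:R * d)) (g j)) =
  rising (alpha + M%:R * d) (g M.+1) * ((rising (alpha + 1) (g 1%N))^-1 *
  \prod_(2 <= j < M.+1) ((alpha + (j%:R - 1) * d) /
                         ((g j)%:R + alpha + (j%:R - 1) * d))).
  by rewrite h gM /rising big_nil mul1r.
elim: M M0 {gM} => // -[_ _|M IH _].
  rewrite big_nat1 big_geq// mulr1; congr (_ / rising _ _); ring.
rewrite big_nat_recr//= IH// [in RHS]big_nat_recr//=.
(* The new denominator has the base of the pending numerator plus 1, and the same length, so their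
   quotient is x / (G + x). *)
rewrite (_ : 1 - d + _ = alpha + M.+1%:R * d + 1); last by rewrite -natr1; ring.
rewrite (_ : (M.+2%:R - 1) * d = M.+1%:R * d); last by rewrite -natr1; ring.
set x := alpha + M.+1%:R * d; set G := g M.+2.
have x0 : 0 < x.
  have Md : 0 <= M%:R * d by rewrite mulr_ge0 ?(ltW d0).
  by rewrite /x -natr1 mulrDl mul1r; lra.
have r0 : rising (x + 1) G != 0.
  by rewrite /rising gt_eqF// prodr_gt0// => i _; rewrite -addrA ltr_wpDr ?addr_ge0.
have Gx : G%:R + x != 0 by rewrite gt_eqF// ltr_wpDl.
have -> : G%:R + alpha + M.+1%:R * d = G%:R + x by rewrite addrA.
have e : rising x G / rising (x + 1) G = x / (G%:R + x).
  by apply/eqP; rewrite eqr_div// -rising_shift mulrC.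
rewrite -e; ring.
Qed.

Lemma mem_set_itvoo (R : realType) (a b x : R) :
  (x \in (`]a, b[%classic : set R)) = (a < x < b).
Proof. by apply/idP/idP; rewrite inE/= in_itv. Qed.

Section beta_moments.
Context (R : realType) (dT : measure_display) (T : measurableType dT).
Variables (P : probability T R) (X : {RV P >-> R}) (a b : R).
Hypotheses (a0 : 0 < a) (b0 : 0 < b) (Xab : Beta_distributed X a b).
Notation mu := (@lebesgue_measure R).

(* Set to 0 outside ]0, 1[ to be nonnegative there as well. *)
Definition unit_monomial (e f : nat) (x : R) : R :=
  if 0 < x < 1 then x ^+ e * (1 - x) ^+ f else 0.

Lemma unit_monomial_itv01 e f x : 0 <= unit_monomial e f x <= 1.
Proof.
rewrite /unit_monomial; case: ifP => [/andP[/ltW x0 /ltW x1]|_]; last first.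
  by rewrite lexx ler01.
have y0 : 0 <= 1 - x by rewrite subr_ge0.
have y1 : 1 - x <= 1 by rewrite lerBlDr lerDl.
by rewrite mulr_ge0 ?exprn_ge0//= mulr_ile1 ?exprn_ge0 ?exprn_ile1.
Qed.

Lemma measurable_unit_monomial e f : measurable_fun setT (unit_monomial e f).
Proof.
have -> : unit_monomial e f =
    (fun x : R => x ^+ e * (1 - x) ^+ f) \_ (`]0, 1[%classic : set R).
  apply/funext => x; rewrite /unit_monomial patchE.
  by rewrite mem_set_itvoo.
apply/(measurable_restrictT _ _).1 => //.
apply: measurable_funM; apply: measurable_funX => //.
exact: measurable_funB.
Qed.

Lemma Beta_densityE :
  Beta_density a b =
  (fun t => t `^ (a - 1) * (1 - t) `^ (b - 1) / Beta a b) \_ (`]0, 1[%classic : set R).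
Proof.
apply/funext => x; rewrite /Beta_density patchE.
by rewrite mem_set_itvoo.
Qed.

Lemma Beta_ge0 : 0 <= Beta a b.
Proof. by apply: Rintegral_ge0 => t _; rewrite beta_kernel_ge0. Qed.

Lemma Beta_density_ge0 t : 0 <= Beta_density a b t.
Proof.
rewrite /Beta_density; case: ifP => // _.
by rewrite divr_ge0 ?beta_kernel_ge0 ?Beta_ge0.
Qed.

Lemma measurable_Beta_density : measurable_fun setT (Beta_density a b).
Proof.
rewrite Beta_densityE; apply/(measurable_restrictT _ _).1 => //.
by apply: measurable_funM => //; exact: measurable_beta_kernel.
Qed.

(* A divergent integral would give [Beta a b = 0], and with [x / 0 = 0] the
   density would vanish: having a Beta law forces convergence. *)
Lemma Beta_distributed_neq0 : Beta a b != 0.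
Proof.
apply/eqP => B0; have := Xab measurableT.
rewrite probability_setT integral0_eq => [/eqP|t _]; first by rewrite onee_eq0.
by rewrite /Beta_density B0 invr0 mulr0; case: ifP.
Qed.

Lemma Beta_distributed_lty : (beta_integral a b < +oo)%E.
Proof.
rewrite -ge0_fin_numE ?beta_integral_ge0//; apply: contraNT Beta_distributed_neq0.
rewrite /Beta /Rintegral -/(beta_integral a b).
by have := beta_integral_ge0 a b; case: (beta_integral a b).
Qed.

(** Permits replacing a polynomial in [X], not bounded by 1 everywhere, by [unit_monomial]. *)
Lemma Beta_distributed_ae : {ae P, forall t, 0 < X t < 1}.
Proof.
have mI : measurable (~` `]0, 1[%classic : set R) by exact: measurableC.
exists (X @^-1` (~` `]0, 1[%classic)); split.
- by rewrite -[X in measurable X]setTI; exact: measurable_funPT.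
- have := Xab mI; rewrite /distribution/pushforward => ->.
  apply: integral0_eq => t /=; rewrite in_itv/= => /negP/negPf t01.
  by rewrite /Beta_density t01.
- by move=> t; rewrite /= in_itv.
Qed.

Lemma Beta_distributed_moment e f :
  (\int[P]_t (unit_monomial e f (X t))%:E =
   (rising a e * rising b f / rising (a + b) (e + f))%:E)%E.
Proof.
have [h1 h2] := Beta_natD e f a0 b0 Beta_distributed_lty.
have psi0 x : 0 <= unit_monomial e f x by case/andP: (unit_monomial_itv01 e f x).
transitivity (\int[mu]_t ((Beta_density a b t)%:E * (unit_monomial e f t)%:E))%E.
  transitivity (\int[P]_t ((1 : R)%:E * (unit_monomial e f (X t))%:E))%E.
    by apply: eq_integral => t _; rewrite mul1e.
  apply: (@eq_integral_weighted_comp _ _ _ _ _ _ _ P mu (fun=> 1)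
    (Beta_density a b) X id (EFin \o unit_monomial e f)) => //.
  - exact: measurable_Beta_density.
  - exact: Beta_density_ge0.
  - move=> B mB.
    transitivity (distribution P X B).
      transitivity (\int[P]_t (\1_(X @^-1` B) t)%:E)%E.
        by apply: eq_integral => t _; rewrite mul1r.
      rewrite integral_indic ?setIT//.
      by rewrite -[X in measurable X]setTI; exact: measurable_funPT.
    rewrite Xab// [LHS]integral_mkcond; apply: eq_integral => t _.
    by rewrite patchE indicE; case: ifP => _; rewrite ?mulr1 ?mulr0.
  - by apply/measurable_EFinP; exact: measurable_unit_monomial.
(* The monomial only shifts the exponents of the density, while the normalising constant stays that
   of (a, b). *)
transitivity (\int[mu]_(t in `]0%R, 1%R[)
   ((Beta a b)^-1%:E * (t `^ (a + e%:R - 1) * (1 - t) `^ (b + f%:R - 1))%:E))%E.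
  rewrite [RHS]integral_mkcond; apply: eq_integral => t _.
  rewrite patchE Beta_densityE patchE.
  case: ifPn => [|_]; last by rewrite mul0e.
  rewrite inE/= in_itv/= => /[dup] t01 /andP[t0 t1].
  rewrite -!EFinM /unit_monomial t01; congr EFin.
  have t1' : 0 < 1 - t by rewrite subr_gt0.
  rewrite (addrAC a) (addrAC b) [in RHS]powRD ?(gt_eqF t0) ?implybT//.
  rewrite [X in _ = _ * (_ * X)]powRD ?(gt_eqF t1') ?implybT//.
  by rewrite !powR_mulrn ?ltW//; ring.
rewrite ge0_integralZl//=.
- rewrite -/(beta_integral (a + e%:R) (b + f%:R)).
  by rewrite (EFin_Beta h1) -EFinM h2 mulrC mulfK// Beta_distributed_neq0.
- by apply/measurable_EFinP; exact: measurable_beta_kernel.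
- by move=> t _; rewrite lee_fin beta_kernel_ge0.
- by rewrite lee_fin invr_ge0 Beta_ge0.
Qed.
End beta_moments.

(** * Law of the labels *)

(** Conditional independence makes the product a version of the conditional probability of the joint
    event; its defining equation is tested on the whole space. *)
Lemma prob_labels_integral (R : realType) (n : nat) (dT : measure_display)
    (T : measurableType dT) (P : probability T R) (G : set (set T))
    (p : nat -> T -> R) (Z : 'I_n -> {RV P >-> nat}) (z : 'I_n -> nat) :
  G setT -> cond_independent G Z ->
  (forall i, cond_prob_version P G [set t | Z i t = z i] (p (z i))) ->
  P [set t | forall i, Z i t = z i] = (\int[P]_t (\prod_(i < n) p (z i) t)%:E)%E.
Proof.
move=> GT indepZ lawZ.
have [_ _ /(_ _ GT) ->] := indepZ (fun i => [set z i]) (fun i => p (z i)) lawZ.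
rewrite setTI; congr (P _); apply/seteqP; split => t /= h i; last exact: h.
by move=> _; exact: h.
Qed.

Lemma integral_stick_breaking_monomial (R : realType) (d alpha : R)
    (dT : measure_display) (T : measurableType dT) (P : probability T R)
    (v : nat -> {RV P >-> R}) (e f : nat -> nat) (M : nat) :
  d < 1 -> (forall i, (1 <= i)%N -> 0 < alpha + i%:R * d) ->
  mutually_independent [set i : nat | (1 <= i)%N] v ->
  (forall i : nat, (1 <= i)%N ->
     Beta_distributed (v i) (1 - d) (alpha + i%:R * d)) ->
  (\int[P]_t (\prod_(1 <= j < M) (v j t ^+ e j * (1 - v j t) ^+ f j))%:E =
   (\prod_(1 <= j < M) (rising (1 - d) (e j) * rising (alpha + j%:R * d) (f j) /
      rising (1 - d + (alpha + j%:R * d)) (e j + f j)))%:E)%E.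
Proof.
move=> d1 b0 v_indep v_beta.
have a0 : 0 < 1 - d by rewrite subr_gt0.
have mv j : measurable_fun setT (v j) by exact: measurable_funPT.
have v01 : {ae P, forall t, forall j, (1 <= j)%N -> 0 < v j t < 1}.
  apply: ae_foralln => j; case: (leqP 1 j) => [j1|_].
    by apply: filterS (Beta_distributed_ae (v_beta j j1)).
  by apply: filterE => t.
have in1 j : j \in index_iota 1 M -> (1 <= j)%N by rewrite mem_index_iota => /andP[].
(* The truncated monomials take values in [0, 1] everywhere, as the product rule for independent
   variables requires; the change affects only a null set. *)
transitivity (\int[P]_t
    (\prod_(j <- index_iota 1 M) unit_monomial (e j) (f j) (v j t))%:E)%E.
  apply: ae_eq_integral => //.
  - apply/measurable_EFinP; apply: measurable_prod => j _.
    by apply: measurable_funM; apply: measurable_funX => //; exact: measurable_funB.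
  - apply/measurable_EFinP; apply: measurable_prod => j _.
    by apply: (measurableT_comp (measurable_unit_monomial _ _)).
  - apply: filterS v01 => t v01 _; congr EFin; apply: eq_big_seq => j /in1 j1.
    by rewrite /unit_monomial v01.
rewrite (integral_prod_independent v_indep
  (phi := fun j => unit_monomial (e j) (f j))).
- rewrite -prodEFin; apply: eq_big_seq => j /in1 j1.
  by rewrite (Beta_distributed_moment a0 (b0 _ j1) (v_beta _ j1)).
- exact: iota_uniq.
- by move=> j /in1.
- by move=> j; exact: measurable_unit_monomial.
- by move=> j x; exact: unit_monomial_itv01.
Qed.

Theorem proposition2p2 (R : realType) (d alpha : R)
  (hd : 0 < d < 1) (halpha : - d < alpha) (n : nat) (hn : (1 <= n)%N)
  (dT : measure_display) (T : measurableType dT) (P : probability T R)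
  (v : nat -> {RV P >-> R})
  (v_indep : mutually_independent [set i : nat | (1 <= i)%N] v)
  (v_beta : forall i : nat, (1 <= i)%N ->
     Beta_distributed (v i) (1 - d) (alpha + i%:R * d))
  (Z : 'I_n -> {RV P >-> nat})
  (Z_pos : forall i t, (1 <= Z i t)%N)
  (Z_cond_indep : cond_independent
     (sigma_of [set j : nat | (1 <= j)%N] (stick_breaking (fun i => v i))) Z)
  (Z_cond_law : forall (i : 'I_n) (j : nat), (1 <= j)%N ->
     cond_prob_version P
       (sigma_of [set j : nat | (1 <= j)%N] (stick_breaking (fun i => v i)))
       [set t | Z i t = j] (stick_breaking (fun i => v i) j))
  (z : 'I_n -> nat) (hz : forall i, (1 <= z i)%N) :
  (alpha <> 0 ->
   P [set t | forall i, Z i t = z i] =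
   (1 / rising alpha n
    * (\prod_(c in level_blocks z) (Gamma (#|c|%:R + 1 - d) / Gamma (1 - d)))
    * \prod_(1 <= j < (max_label z).+1)
        ((alpha + (j%:R - 1) * d)
         / ((count_ge z j)%:R + alpha + (j%:R - 1) * d)))%:E)
  /\
  (* Cancelled form: rising alpha n = alpha * \prod_(1 <= j < n) (alpha + j),
     and the j = 1 numerator is alpha. *)
  (alpha = 0 ->
   P [set t | forall i, Z i t = z i] =
   (1 / (\prod_(1 <= j < n) (alpha + j%:R))
    * (\prod_(c in level_blocks z) (Gamma (#|c|%:R + 1 - d) / Gamma (1 - d)))
    * (1 / ((count_ge z 1)%:R + alpha)
       * \prod_(2 <= j < (max_label z).+1)
           ((alpha + (j%:R - 1) * d)
            / ((count_ge z j)%:R + alpha + (j%:R - 1) * d))))%:E).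
Proof.
case/andP: hd => d0 d1.
have a0 : 0 < 1 - d by rewrite subr_gt0.
have b0 i : (1 <= i)%N -> 0 < alpha + i%:R * d.
  case: i => // i _; have : 0 <= i%:R * d by rewrite mulr_ge0 ?(ltW d0).
  by rewrite -natr1 mulrDl mul1r; lra.
have GT : sigma_of [set j : nat | (1 <= j)%N] (stick_breaking (fun i => v i)) setT.
  by move=> B [[B0 BC _] _]; rewrite -(setD0 setT); exact: BC.
set Q := P _.
(* A form common to both cases, with the factor alpha already cancelled. *)
have -> : Q =
  (\prod_(c in level_blocks z) (Gamma (#|c|%:R + 1 - d) / Gamma (1 - d)) *
    ((rising (alpha + 1) n)^-1 *
     \prod_(2 <= j < (max_label z).+1)
        ((alpha + (j%:R - 1) * d)
         / ((count_ge z j)%:R + alpha + (j%:R - 1) * d))))%:E.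
  rewrite /Q (prob_labels_integral GT Z_cond_indep (fun i => Z_cond_law i _ (hz i))).
  under eq_integral do rewrite prod_stick_breaking//.
  rewrite (integral_stick_breaking_monomial (level_count z)
    (fun j => count_ge z j.+1) (max_label z).+1 d1 b0 v_indep v_beta); congr EFin.
  (* Rising factorials equal 1 at length 0, so the product over blocks can become one over all
     labels up to the maximum. *)
  rewrite (eq_bigr (fun c : {set 'I_n} => rising (1 - d) #|c|)); last first.
    move=> c _; rewrite -addrA Gamma_natD// mulfK//.
    by rewrite gt_eqF// Gamma_gt0.
  rewrite (prod_level_blocks hz); last by rewrite /rising big_nil.
  rewrite -[X in rising (alpha + 1) X](count_ge1 hz).
  rewrite -prod_rising_telescope//; last 2 first.
  - by rewrite (leq_trans (hz (Ordinal hn)))// -ltnS ltn_max_label.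
  - exact: count_ge_max.
  rewrite -big_split/=; apply: eq_bigr => j _.
  by rewrite mulrA -count_ge_level.
have risingE x m : rising x m.+1 = x * \prod_(1 <= j < m.+1) (x + j%:R) :> R.
  by rewrite /rising big_ltn// addr0.
have n0 : n%:R + alpha != 0.
  rewrite gt_eqF//; have : 1 <= n%:R :> R by rewrite ler1n.
  by lra.
have prod0 : \prod_(1 <= j < n) (alpha + j%:R) != 0.
  rewrite gt_eqF// big_seq prodr_gt0// => j; rewrite mem_index_iota => /andP[j1 _].
  have : 1 <= j%:R :> R by rewrite ler1n.
  by lra.
(* The last factor n + alpha is the denominator of the j = 1 factor, since g_1 = n. *)
have r1 : rising (alpha + 1) n = \prod_(1 <= j < n) (alpha + j%:R) * (n%:R + alpha).
  rewrite /rising -[X in \prod_(_ <= _ < X) _]prednK// big_nat_recr//=.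
  rewrite [in RHS](_ : n = n.-1.+1) ?prednK// big_add1/=.
  congr (_ * _); last by rewrite -[in RHS](prednK hn) -natr1; ring.
  by apply: eq_bigr => i _; rewrite -natr1; ring.
have c1 : count_ge z 1 = n by exact: count_ge1.
split=> alpha0; congr EFin.
- move/eqP in alpha0.
  rewrite [in RHS]big_ltn; last first.
    by rewrite ltnS (leq_trans (hz (Ordinal hn)))// -ltnS ltn_max_label.
  rewrite c1 subrr mul0r !addr0 r1.
  have -> : rising alpha n = alpha * \prod_(1 <= j < n) (alpha + j%:R).
    by rewrite -(prednK hn) risingE.
  by field; rewrite n0 prod0 alpha0.
- by rewrite c1 r1; field; rewrite n0 prod0.
Qed.
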